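(* Let $(G,H,\sigma)$ be a $1$-dimensional Hecke triple, and suppose that $\sigma$ extends to a (unitary) character of $G$, also denoted $\sigma$. Then the map $$\Phi(f)(x)=\overline{\sigma(x)}f(x)$$ for $f\in\mathcal{H}_\sigma(G,H)$ and $x\in G$, is a $*$-isomorphism of $\mathcal{H}_\sigma(G,H)$ onto $\mathcal{H}(G,H)$.
   Context: A $1$-dimensional Hecke triple $(G,H,\sigma)$ consists of a group $G$, a subgroup $H$ with $[H:H\cap xHx^{-1}]<\infty$ for all $x\in G$, and a unitary character $\sigma:H\to\mathbb{T}$ with finite range. Put $K=\ker\sigma$. For a subgroup $S\in\{H,K\}$ let $\Delta_S(x)=[S:S\cap xSx^{-1}]/[S:S\cap x^{-1}Sx]$. $\mathcal{H}_\sigma(G,H)$ is the $*$-algebra of functions $f:G\to\mathbb{C}$ with finite support in $H\backslash G/H$ and $f(hxk)=\sigma(h)f(x)\sigma(k)$ for $h,k\in H$, $x\in G$, with convolution $f*g(x)=\sum_{yH\in G/H}f(y)g(y^{-1}x)$ and involution $f^*(x)=\Delta_K(x^{-1})\overline{f(x^{-1})}$. $\mathcal{H}(G,H)$ is the case of the trivial character: $H$-biinvariant functions with finite support in $H\backslash G/H$, the same convolution, and involution $f^*(x)=\Delta_H(x^{-1})\overline{f(x^{-1})}$. *)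

(* Defs.v *)
From HB Require Import structures.
From mathcomp Require Import all_boot all_order all_algebra finmap.
From mathcomp Require Import mathcomp_extra boolp classical_sets functions.
From mathcomp Require Import cardinality fsbigop reals.
From mathcomp Require Import complex.

Set Implicit Arguments.
Unset Strict Implicit.
Unset Printing Implicit Defensive.

Import Order.TTheory GRing.Theory Num.Theory.

Local Open Scope classical_set_scope.
Local Open Scope ring_scope.

Section Cosets.
Variable G : groupType.
Implicit Types (S L H : set G) (x : G).

Definition left_coset S x : set G := [set (x * s)%g | s in S].

Definition conj_set x S : set G := [set (x * s * x^-1)%g | s in S].

Definition double_coset H x : set G := [set (h * x * k)%g | h in H & k in H].

Definition left_cosets_in L S : set (set G) := left_coset L @` S.

(* The index [S : L], for L contained in S; it is 0 if the index is infinite. *)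
Definition index L S : nat := #|` fset_set (left_cosets_in L S)|.

Definition modular (C : fieldType) S x : C :=
  (index (S `&` conj_set x S) S)%:R / (index (S `&` conj_set x^-1%g S) S)%:R.

End Cosets.
Arguments modular {G} C S x.

Definition is_subgroup (G : groupType) (S : set G) := group_closed (mem S).

(* Only the values of chi on S matter. *)
Definition unitary_character (R : realType) (G : groupType) (S : set G)
    (chi : G -> R[i]) : Prop :=
  (forall x, S x -> `|chi x| = 1) /\
  (forall x y, S x -> S y -> chi (x * y)%g = chi x * chi y).

(* The character is represented by a function on G of which only the
   restriction to the subgroup is meaningful. *)
Record heckeTriple (R : realType) (G : groupType) := HeckeTriple {
  hgroup : set G;
  hchar : G -> R[i];
  hgroup_subgroup : is_subgroup hgroup;
  hgroup_finite_index : forall x : G,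
    finite_set (left_cosets_in (hgroup `&` conj_set x hgroup) hgroup);
  hchar_character : unitary_character hgroup hchar;
  hchar_finite_range : finite_set (hchar @` hgroup)
}.

Section HeckeFunctions.
Variables (R : realType) (G : groupType) (T : heckeTriple R G).
Local Notation H := (hgroup T).
Local Notation sigma := (hchar T).
Implicit Types f g : G -> R[i].

Definition hker : set G := [set h | H h /\ sigma h = 1].

Definition is_hecke f : Prop :=
  finite_set (double_coset H @` [set x | f x != 0]) /\
  (forall h k x, H h -> H k -> f (h * x * k)%g = sigma h * f x * sigma k).

(* The summand indexed by a left coset c is evaluated at a representative
   of c; for Hecke functions f and g it does not depend on this choice. *)
Definition hecke_conv f g : G -> R[i] := fun x =>
  \sum_(c \in range (left_coset H))
     f (xget 1%g c) * g ((xget 1%g c)^-1 * x)%g.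

Definition hecke_star f : G -> R[i] := fun x =>
  modular R[i] hker x^-1%g * (f x^-1%g)^*.

End HeckeFunctions.

Section Groups.
Variables (G : groupType) (S : set G).
Hypothesis S_sub : is_subgroup S.

Lemma subgroup1 : S 1%g.
Proof. by have [/set_mem] := S_sub. Qed.

Lemma subgroupV x : S x -> S x^-1%g.
Proof. by move=> Sx; apply/set_mem/(group_closedV S_sub)/mem_set. Qed.

Lemma subgroupM x y : S x -> S y -> S (x * y)%g.
Proof. by move=> Sx Sy; apply/set_mem/(group_closedM S_sub); exact/mem_set. Qed.

Lemma conj_setE x y : conj_set x S y <-> S (x^-1 * y * x)%g.
Proof.
split=> [[s Ss <-]|Sy]; first by rewrite !mulgA mulVg mul1g mulgVK.
by exists (x^-1 * y * x)%g => //; rewrite !mulgA mulgV mul1g mulgK.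
Qed.

Lemma left_coset_eq x y : S (x^-1 * y)%g -> left_coset S x = left_coset S y.
Proof.
move=> Sxy; apply/seteqP; split=> [_ [s Ss <-]|_ [s Ss <-]].
  exists (y^-1 * x * s)%g; last by rewrite !mulgA mulgV mul1g.
  by apply: subgroupM => //; rewrite -[x]invgK -invgM; exact: subgroupV.
exists (x^-1 * y * s)%g; last by rewrite !mulgA mulgV mul1g.
exact: subgroupM.
Qed.

Lemma left_coset_repr x :
  exists2 s, S s & xget 1%g (left_coset S x) = (x * s)%g.
Proof.
have : left_coset S x (xget 1%g (left_coset S x)).
  by apply: xgetPex; exists x, 1%g; [exact: subgroup1|rewrite mulg1].
by case=> s Ss <-; exists s.
Qed.

Lemma double_coset_eq h x k : S h -> S k ->
  double_coset S (h * x * k)%g = double_coset S x.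
Proof.
move=> Sh Sk; apply/seteqP; split=> _ [a Sa [b Sb <-]].
  exists (a * h)%g; first exact: subgroupM.
  by exists (k * b)%g; [exact: subgroupM|rewrite !mulgA].
exists (a * h^-1)%g; first by apply: subgroupM => //; exact: subgroupV.
exists (k^-1 * b)%g; first by apply: subgroupM => //; exact: subgroupV.
by rewrite !mulgA mulgVK mulgK.
Qed.

Lemma double_cosetP x y :
  double_coset S x = double_coset S y ->
  exists h k, [/\ S h, S k & x = (h * y * k)%g].
Proof.
move=> exy; have : double_coset S x x.
  exists 1%g; first exact: subgroup1.
  by exists 1%g; [exact: subgroup1|rewrite mul1g mulg1].
by rewrite exy => -[h Sh [k Sk <-]]; exists h, k.
Qed.

End Groups.

Section Index.
Variables (G : groupType) (K : set G).

Lemma conj_setM x y (L : set G) :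
  conj_set (x * y)%g L = conj_set x (conj_set y L).
Proof.
apply/seteqP; split=> [_ [s Ks <-]|_ [_ [s Ks <-] <-]].
  by exists (y * s * y^-1)%g; [exists s|rewrite invgM !mulgA].
by exists s => //; rewrite invgM !mulgA.
Qed.

Lemma index_conj h L : conj_set h K = K ->
  index (K `&` conj_set h L) K = index (K `&` L) K.
Proof.
move=> hK; rewrite /index; set A := left_cosets_in _ _; set B := left_cosets_in _ _.
have cinj : injective (conj_set h).
  move=> X Y XY; apply/seteqP; split=> z Xz.
    have : conj_set h X (h * z * h^-1)%g by exists z.
    by rewrite XY => -[w Yw] /mulIg/mulgI <-.
  have : conj_set h Y (h * z * h^-1)%g by exists z.
  by rewrite -XY => -[w Yw] /mulIg/mulgI <-.
have cK z : K z -> K (h * z * h^-1)%g by move=> Kz; rewrite -hK; exists z.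
have cKV z : K (h * z * h^-1)%g -> K z.
  by rewrite -{1}hK => -[w Kw] /mulIg/mulgI <-.
have ccoset z : conj_set h (left_coset (K `&` L) z) =
    left_coset (K `&` conj_set h L) (h * z * h^-1)%g.
  apply/seteqP; split=> [_ [_ [s [Ks Ls] <-] <-]|_ [w [Kw [s Ls sw]] <-]].
    exists (h * s * h^-1)%g; last by rewrite !mulgA mulgVK.
    by split; [exact: cK|exists s].
  exists (z * s)%g; last by rewrite -sw !mulgA mulgVK.
  by exists s => //; split => //; apply: cKV; rewrite sw.
have -> : A = conj_set h @` B.
  apply/seteqP; split=> [_ [y Ky <-]|_ [_ [y Ky <-] <-]].
    have : conj_set h K y by rewrite hK.
    by case=> z Kz <-; exists (left_coset (K `&` L) z); [exists z|].
  by exists (h * y * h^-1)%g; [exact: cK|rewrite ccoset].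
have [Bfin|Binf] := pselect (finite_set B).
  apply/fcard_eq; [exact: finite_image|exact: Bfin|].
  by apply: inj_card_eq => X Y _ _; exact: cinj.
rewrite /fset_set; case: pselect => [cBfin|_]; last by case: pselect.
by case: Binf; rewrite -(eq_finite_set (inj_card_eq (fun X Y _ _ => @cinj X Y))).
Qed.

Lemma modular_double (C : fieldType) h k x :
  conj_set h K = K -> conj_set k K = K ->
  conj_set h^-1%g K = K -> conj_set k^-1%g K = K ->
  modular C K (h * x * k)%g = modular C K x.
Proof.
move=> hK kK hVK kVK; rewrite /modular !invgM mulgA; congr (_%:R / _%:R).
  by rewrite !conj_setM kK index_conj.
by rewrite -mulgA !conj_setM hVK index_conj.
Qed.

End Index.

Section HeckeTheory.
Variables (R : realType) (G : groupType) (T : heckeTriple R G).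
Local Notation H := (hgroup T).
Local Notation sigma := (hchar T).
Local Notation K := (hker T).
Local Notation H_sub := (hgroup_subgroup T).

#[local] Hint Resolve hgroup_subgroup : core.

Lemma hcharM h k : H h -> H k -> sigma (h * k)%g = sigma h * sigma k.
Proof. by case: (hchar_character T) => _; apply. Qed.

Lemma hchar_neq0 h : H h -> sigma h != 0.
Proof.
case: (hchar_character T) => s1 _ Hh.
by rewrite -normr_eq0 s1 // oner_eq0.
Qed.

Lemma hchar1 : sigma 1%g = 1.
Proof.
have H1 := subgroup1 H_sub; apply: (mulfI (hchar_neq0 H1)).
by rewrite -hcharM // mulg1 mulr1.
Qed.

Lemma hcharV h : H h -> sigma h^-1%g = (sigma h)^*.
Proof.
move=> Hh; have HV := subgroupV H_sub Hh.
apply: (mulfI (hchar_neq0 Hh)); rewrite -hcharM // mulgV hchar1.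
case: (hchar_character T) => s1 _.
by rewrite -normCK s1 // expr1n.
Qed.

Lemma conj_hker h : H h -> conj_set h K = K.
Proof.
have sub h0 : H h0 -> conj_set h0 K `<=` K.
  move=> Hh _ [k [Hk k1] <-]; have HV := subgroupV H_sub Hh.
  have Hhk := subgroupM H_sub Hh Hk.
  split; first exact: subgroupM.
  by rewrite hcharM // hcharM // k1 mulr1 -hcharM // mulgV hchar1.
move=> Hh; apply/seteqP; split; first exact: sub.
move=> k Kk; exists (h^-1 * k * h)%g; last by rewrite !mulgA mulgV mul1g mulgK.
by apply: (sub _ (subgroupV H_sub Hh)); exists k => //; rewrite invgK.
Qed.

Lemma hecke0 : is_hecke T 0.
Proof.
split=> [|h k x _ _]; last by rewrite [LHS]/= [X in _ * X * _]/= mulr0 mul0r.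
rewrite (_ : [set x | _] = set0) ?image_set0 //.
by apply/seteqP; split=> x //=; rewrite eqxx.
Qed.

Lemma heckeD f g : is_hecke T f -> is_hecke T g -> is_hecke T (f + g).
Proof.
move=> [ff fE] [gf gE]; split=> [|h k x Hh Hk]; last first.
  by rewrite /= !fctE fE // gE // mulrDr mulrDl.
apply: (@sub_finite_set _ _ (double_coset H @` [set x | f x != 0] `|`
    double_coset H @` [set x | g x != 0])); last by rewrite finite_setU.
move=> _ [x /= + <-]; rewrite fctE => fgx.
have [fx0|fx] := eqVneq (f x) 0; last by left; exists x.
by right; exists x => //=; move: fgx; rewrite fx0 add0r.
Qed.

Lemma heckeZ (a : R[i]) f : is_hecke T f -> is_hecke T (a *: f).
Proof.
move=> [ff fE]; split=> [|h k x Hh Hk]; last first.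
  have -> y : (a *: f) y = a * f y by [].
  by rewrite fE // !mulrA (mulrC a).
apply: sub_finite_set ff => _ [x /= + <-]; rewrite fctE => fx.
by exists x => //=; apply: contra_neq fx => ->; rewrite scaler0.
Qed.

Lemma hecke_star_closed f : is_hecke T f -> is_hecke T (hecke_star T f).
Proof.
move=> [ff fE]; split=> [|h k x Hh Hk]; last first.
  have [HhV HkV] := (subgroupV H_sub Hh, subgroupV H_sub Hk).
  rewrite /hecke_star !invgM mulgA modular_double; first last.
  - by rewrite invgK conj_hker.
  - by rewrite invgK conj_hker.
  - by rewrite conj_hker.
  - by rewrite conj_hker.
  rewrite fE // !rmorphM /= -!hcharV // !invgK.
  move: (modular _ _ _) (_^*) => m y.
  rewrite [RHS]mulrC -[in LHS]mulrA mulrCA [in RHS]mulrCA (mulrC y).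
  by rewrite (mulrCA m) (mulrCA (sigma k)).
have inv_dc x : double_coset H x^-1%g = [set y^-1%g | y in double_coset H x].
  apply/seteqP; split=> [_ [h Hh [k Hk <-]]|_ [_ [h Hh [k Hk <-]] <-]].
    exists (k^-1 * x * h^-1)%g; last by rewrite !invgM !invgK mulgA.
    exists k^-1%g; first exact: subgroupV.
    by exists h^-1%g => //; exact: subgroupV.
  exists k^-1%g; first exact: subgroupV.
  by exists h^-1%g; [exact: subgroupV|rewrite !invgM mulgA].
apply: (@sub_finite_set _ _ ((fun A : set G => [set y^-1%g | y in A]) @`
  (double_coset H @` [set x | f x != 0]))); last exact: finite_image.
move=> _ [x /= fx <-]; exists (double_coset H x^-1%g); last first.
  by rewrite -inv_dc invgK.
exists x^-1%g => //=; apply: contra_neq fx => fx.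
by rewrite /hecke_star fx conjC0 mulr0.
Qed.

Lemma hecke_conv_equivariant f g h k x :
  is_hecke T f -> is_hecke T g -> H h -> H k ->
  hecke_conv T f g (h * x * k)%g = sigma h * hecke_conv T f g x * sigma k.
Proof.
move=> [_ fE] [_ gE] Hh Hk.
have H1 := subgroup1 H_sub.
have trM y z : [set (y * u)%g | u in left_coset H z] = left_coset H (y * z)%g.
  apply/seteqP; split=> [_ [_ [s Hs <-] <-]|_ [s Hs <-]].
    by exists s; rewrite ?mulgA.
  by exists (z * s)%g; [exists s|rewrite mulgA].
have bij : set_bij (range (left_coset H)) (range (left_coset H))
    (fun c : set G => [set (h * u)%g | u in c]).
  split.
  - by move=> _ [y _ <-]; rewrite trM; exists (h * y)%g.
  - move=> _ _ /set_mem[y _ <-] /set_mem[z _ <-]; rewrite !trM => eyz.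
    have := congr1 (fun c : set G => [set (h^-1 * u)%g | u in c]) eyz.
    by rewrite !trM !mulgA mulVg !mul1g.
  - move=> _ [y _ <-]; exists (left_coset H (h^-1 * y)%g).
      by exists (h^-1 * y)%g.
    by rewrite trM mulgA mulgV mul1g.
rewrite /hecke_conv (reindex_fsbig _ _ _ _ bij) mulr_fsumr mulr_fsuml.
apply: eq_fsbigr => _ /set_mem[y _ <-].
rewrite trM.
have [s Hs ->] := left_coset_repr H_sub (h * y)%g.
have [t Ht ->] := left_coset_repr H_sub y.
have HsV := subgroupV H_sub Hs; have HtV := subgroupV H_sub Ht.
have fR z u : H u -> f (z * u)%g = f z * sigma u.
  by move=> Hu; have := fE 1%g u z H1 Hu; rewrite mul1g hchar1 mul1r.
have -> : ((h * y * s)^-1 * (h * x * k) = s^-1 * (y^-1 * x) * k)%g.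
  by rewrite !invgM !mulgA mulgVK.
have -> : ((y * t)^-1 * x = t^-1 * (y^-1 * x) * 1)%g.
  by rewrite !invgM !mulgA mulg1.
have charVK z : H z -> sigma z * sigma z^-1%g = 1.
  by move=> Hz; rewrite -hcharM ?mulgV ?hchar1 //; exact: subgroupV.
rewrite fE // fR // !gE // hchar1 mulr1.
have := charVK t Ht; have := charVK s Hs.
move: (f y) (g _) (sigma s) (sigma t) => a b u v uE vE.
rewrite -(mulrA _ u) -(mulrA a v) !(mulrA u) !(mulrA v) uE vE !mul1r.
by rewrite !mulrA.
Qed.

Lemma double_coset_repr x : exists h k,
  [/\ H h, H k & xget 1%g (double_coset H x) = (h * x * k)%g].
Proof.
have H1 := subgroup1 H_sub.
have : double_coset H x (xget 1%g (double_coset H x)).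
  by apply: xgetPex; exists x, 1%g => //; exists 1%g; rewrite // mul1g mulg1.
by case=> h Hh [k Hk <-]; exists h, k.
Qed.

Lemma subgroupI_conj b : is_subgroup (H `&` conj_set b H).
Proof.
split=> [|u v /set_mem[Hu bu] /set_mem[Hv bv]]; apply/mem_set; split.
- exact: subgroup1.
- by apply/conj_setE; rewrite mulg1 mulVg; exact: subgroup1.
- by apply: subgroupM => //; exact: subgroupV.
- apply/conj_setE; move/conj_setE: bu => bu; move/conj_setE: bv => bv.
  have := subgroupM H_sub bu (subgroupV H_sub bv).
  by rewrite !invgM invgK !mulgA mulgK.
Qed.

Lemma hecke_conv_closed f g :
  is_hecke T f -> is_hecke T g -> is_hecke T (hecke_conv T f g).
Proof.
move=> Hf Hg; split; last by move=> *; exact: hecke_conv_equivariant.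
case: Hf Hg => [ff _] [gf _].
set A := double_coset H @` _ in ff; set B := double_coset H @` _ in gf.
pose F D E := (fun c : set G => double_coset H
    (xget 1%g D * xget 1%g c * xget 1%g E)%g) @`
  left_cosets_in (H `&` conj_set (xget 1%g E) H) H.
apply: (@sub_finite_set _ _ (\bigcup_(D in A) \bigcup_(E in B) F D E)); last first.
  apply: bigcup_finite => // D _; apply: bigcup_finite => // E _.
  exact/finite_image/hgroup_finite_index.
move=> _ [x /= fgx <-].
have [c] : exists c, f (xget 1%g c) * g ((xget 1%g c)^-1 * x)%g != 0.
  apply: contrapT => /forallNP fg0; move/eqP: fgx; apply.
  by apply: fsbig1 => c _; have /negP := fg0 c; rewrite negbK => /eqP.
set y := xget 1%g c; rewrite mulf_eq0 negb_or => /andP[fy gz].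
set z := (y^-1 * x)%g in gz.
have -> : x = (y * z)%g by rewrite mulgA mulgV mul1g.
exists (double_coset H y); first by exists y.
exists (double_coset H z); first by exists z.
rewrite /F; have [h1 [k1 [Hh1 Hk1 ->]]] := double_coset_repr y.
have [h2 [k2 [Hh2 Hk2 ->]]] := double_coset_repr z.
set b := (h2 * z * k2)%g; set u := (k1^-1 * h2^-1)%g.
have HV := subgroupV H_sub.
have Hu : H u by apply: subgroupM => //; exact: HV.
exists (left_coset (H `&` conj_set b H) u); first by exists u.
have [s [Hs /conj_setE bs] ->] := left_coset_repr (subgroupI_conj b) u.
have -> : (h1 * y * k1 * (u * s) * b = h1 * (y * z) * (k2 * (b^-1 * s * b)))%g.
  by rewrite /u /b !invgM !mulgA !mulgK.
by rewrite (double_coset_eq H_sub) //; exact: subgroupM.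
Qed.

Definition hecke_pred : {pred (G -> R[i])} := [pred f | `[< is_hecke T f >]].

Lemma hecke_submod_closed : submod_closed hecke_pred.
Proof.
split=> [|a f g /asboolP Hf /asboolP Hg]; apply/asboolP; first exact: hecke0.
by apply: heckeD => //; exact: heckeZ.
Qed.

HB.instance Definition _ := GRing.isSubmodClosed.Build R[i] (G -> R[i])
  hecke_pred hecke_submod_closed.

Record hecke := Hecke {
  hecke_fun :> G -> R[i];
  hecke_funP : hecke_fun \in hecke_pred
}.

HB.instance Definition _ := [isSub for hecke_fun].
HB.instance Definition _ := [Choice of hecke by <:].
HB.instance Definition _ := [SubChoice_isSubLmodule of hecke by <:].

Lemma heckeP (f : hecke) : is_hecke T f.
Proof. exact/asboolP/hecke_funP. Qed.

Definition to_hecke f (Hf : is_hecke T f) : hecke := Hecke (asboolT Hf).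

Definition hconv (f g : hecke) : hecke :=
  to_hecke (hecke_conv_closed (heckeP f) (heckeP g)).

Definition hstar (f : hecke) : hecke := to_hecke (hecke_star_closed (heckeP f)).

End HeckeTheory.

Definition is_star_isomorphism (R : realType) (G1 G2 : groupType)
    (T1 : heckeTriple R G1) (T2 : heckeTriple R G2)
    (Phi : hecke T1 -> hecke T2) : Prop :=
  [/\ linear Phi, bijective Phi,
      forall f g, Phi (hconv f g) = hconv (Phi f) (Phi g) &
      forall f, Phi (hstar f) = hstar (Phi f)].

Section TrivialCharacter.
Variables (R : realType) (G : groupType) (T : heckeTriple R G).
Local Notation H := (hgroup T).

Lemma trivial_character : unitary_character H (fun=> 1 : R[i]).
Proof. by split=> [x _|x y _ _]; rewrite ?normr1 ?mulr1. Qed.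

Lemma trivial_finite_range : finite_set ((fun=> 1 : R[i]) @` H).
Proof. by apply: (@sub_finite_set _ _ [set 1]) => // _ [x _ <-]. Qed.

Definition trivial_triple : heckeTriple R G :=
  HeckeTriple (hgroup_subgroup T) (@hgroup_finite_index R G T)
    trivial_character trivial_finite_range.

Lemma hker_trivial : hker trivial_triple = H.
Proof. by apply/seteqP; split=> [x []|x Hx]. Qed.

Lemma hstar_trivialE (f : hecke trivial_triple) x :
  hstar f x = modular R[i] H x^-1%g * (f x^-1%g)^*.
Proof. by rewrite /= /hecke_star hker_trivial. Qed.

Lemma is_hecke_trivialE (f : G -> R[i]) : is_hecke trivial_triple f <->
  finite_set (double_coset H @` [set x | f x != 0]) /\
  (forall h k x, H h -> H k -> f (h * x * k)%g = f x).
Proof.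
by split=> -[ff fE]; split=> // h k x Hh Hk; have := fE h k x Hh Hk;
  rewrite /= ?mul1r ?mulr1.
Qed.

End TrivialCharacter.

(* Main.v *)
Require Import Defs.
From HB Require Import structures.
From mathcomp Require Import all_boot all_order all_algebra finmap.
From mathcomp Require Import mathcomp_extra boolp classical_sets functions.
From mathcomp Require Import cardinality fsbigop reals.
From mathcomp Require Import complex.

(** Multiplication by [(sigma x)^*] turns sigma-equivariant functions into
    biinvariant ones, and commutes with convolution because
    [sigma y * sigma (y^-1 * x) = sigma x] term by term.  The only real point is
    the involution, where the modular functions of K and H must agree.  Writing
    Kx = K `&` xKx^-1 and Hx = H `&` xHx^-1, the subgroup Kx is the kernel of
    sigma on Hx, so computing [H : Kx] through K and through Hx gives
    |sigma(H)| [K : Kx] = [H : Hx] |sigma(Hx)|.  As sigma is a character of all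
    of G, conjugation by x yields sigma(Hx) = sigma(H(x^-1)), and the extra
    factors cancel in the quotient defining the modular function. *)

Set Implicit Arguments.
Unset Strict Implicit.
Unset Printing Implicit Defensive.

Import Order.TTheory GRing.Theory Num.Theory.

Local Open Scope classical_set_scope.
Local Open Scope ring_scope.

(** * Counting left cosets: multiplicativity of the index *)

Lemma cardfsM (T U : choiceType) (A : {fset T}) (B : {fset U}) :
  #|` (A `*` B)%fset| = (#|` A| * #|` B|)%N.
Proof.
rewrite -(size_allpairs pair); apply/perm_size/uniq_perm.
- exact: fset_uniq.
- by apply: allpairs_uniq; [exact: fset_uniq|exact: fset_uniq|move=> [? ?] [? ?]].
- move=> [x y]; rewrite in_fsetM; apply/andP/allpairsP => /=.
    by move=> [Ax By]; exists (x, y).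
  by move=> [[x' y'] [Ax By [-> ->]]].
Qed.

Lemma left_coset_inj (G : groupType) (L : set G) (x y : G) : is_subgroup L ->
  left_coset L x = left_coset L y -> L (x^-1 * y)%g.
Proof.
move=> L_sub exy; have : left_coset L y y.
  by exists 1%g; [exact: subgroup1|rewrite mulg1].
by rewrite -exy => -[s Ls <-]; rewrite mulKg.
Qed.

Section Tower.
Variables (G : groupType) (S M L : set G).
Hypotheses (S_sub : is_subgroup S) (M_sub : is_subgroup M) (L_sub : is_subgroup L).
Hypotheses (MS : M `<=` S) (LM : L `<=` M).

(** The value depends on the representative chosen for the [M]-coset, but that choice is fixed once
    per coset, so [tower] is still a bijection from pairs of cosets onto the cosets of [L] in
    [S]. *)
Let tower (p : set G * set G) : set G :=
  left_coset L (xget 1%g p.1 * xget 1%g p.2)%g.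

Let tower_inj :
  {in left_cosets_in M S `*` left_cosets_in L M &, injective tower}.
Proof.
move=> [a b] [c d] /set_mem[/= [x Sx <-] [m Mm <-]].
move=> /set_mem[/= [y Sy <-] [n Mn <-]]; rewrite /tower /=.
have [m' Lm' ->] := left_coset_repr L_sub m.
have [n' Ln' ->] := left_coset_repr L_sub n.
have Mu : M (m * m')%g by apply: subgroupM => //; exact: LM.
have Mv : M (n * n')%g by apply: subgroupM => //; exact: LM.
have Eu : left_coset L (m * m') = left_coset L m.
  by apply: left_coset_eq => //; rewrite invgM mulgVK; exact: subgroupV.
have Ev : left_coset L (n * n') = left_coset L n.
  by apply: left_coset_eq => //; rewrite invgM mulgVK; exact: subgroupV.
(* The chosen representatives [m * m'] and [n * n'] lie in [M] and give the same [L]-cosets as [m]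
   and [n], so they can replace them throughout. *)
rewrite -Eu -Ev; move: (m * m')%g (n * n')%g Mu Mv => u v Mu Mv {Eu Ev}.
move=> /(left_coset_inj L_sub) Luv.
have exy : left_coset M x = left_coset M y.
  have [s Ms sE] := left_coset_repr M_sub x.
  have [t Mt tE] := left_coset_repr M_sub y.
  rewrite sE tE in Luv.
  (* This exhibits [x^-1 * y] as a product of elements of [M], whose middle factor lies in [L] by
     [Luv]. *)
  have -> : x = (x * s * u * (u^-1 * s^-1))%g by rewrite !mulgA !mulgK.
  apply: left_coset_eq => //.
  have -> : ((x * s * u * (u^-1 * s^-1))^-1 * y =
     (s * u) * ((x * s * u)^-1 * (y * t * v)) * (v^-1 * t^-1))%g.
    by rewrite !invgM !invgK !mulgA !mulgK.
  have Mvt := subgroupM M_sub (subgroupV M_sub Mv) (subgroupV M_sub Mt).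
  exact: subgroupM (subgroupM M_sub (subgroupM M_sub Ms Mu) (LM Luv)) Mvt.
rewrite exy; congr (_, _); apply: left_coset_eq => //.
by move: Luv; rewrite exy invgM -mulgA mulKg.
Qed.

Let tower_im :
  tower @` (left_cosets_in M S `*` left_cosets_in L M) = left_cosets_in L S.
Proof.
apply/seteqP; split=> [_ [[a b] /= [[x Sx <-] [m Mm <-]] <-]|_ [x Sx <-]].
  rewrite /tower /=.
  have [s Ms ->] := left_coset_repr M_sub x.
  have [t Lt ->] := left_coset_repr L_sub m.
  exists (x * s * (m * t))%g => //.
  have Mmt := subgroupM M_sub Mm (LM Lt).
  exact: subgroupM (subgroupM S_sub Sx (MS Ms)) (MS Mmt).
have [s Ms sE] := left_coset_repr M_sub x.
(* The representative of the first coset is [x * s], so the second coset has to undo [s]. *)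
exists (left_coset M x, left_coset L s^-1%g).
  by split; [exists x|exists s^-1%g => //; exact: subgroupV].
rewrite /tower /= sE.
have [t Lt ->] := left_coset_repr L_sub s^-1%g.
apply: left_coset_eq => //.
by rewrite !mulgA mulgK invgM mulgVK; exact: subgroupV.
Qed.

Lemma finite_left_cosets_tower :
  finite_set (left_cosets_in M S) -> finite_set (left_cosets_in L M) ->
  finite_set (left_cosets_in L S).
Proof. by move=> fS fM; rewrite -tower_im; apply/finite_image/finite_setX. Qed.

Lemma index_tower :
  finite_set (left_cosets_in M S) -> finite_set (left_cosets_in L M) ->
  Defs.index L S = (Defs.index M S * Defs.index L M)%N.
Proof.
move=> fS fM; rewrite /Defs.index -cardfsM -fset_setX // -tower_im.
have fSM := finite_setX fS fM.
apply/fcard_eq => //; first exact: finite_image.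
exact/inj_card_eq/tower_inj.
Qed.

End Tower.

(** * The kernel of a unitary character with finite range *)

Section CharacterKernel.
Variables (R : realType) (G : groupType) (S : set G) (chi : G -> R[i]).
Hypotheses (S_sub : is_subgroup S) (chiP : unitary_character S chi).

Let ker : set G := [set h | S h /\ chi h = 1].

Lemma unitary_char_conjM x : S x -> (chi x)^* * chi x = 1.
Proof. by move=> Sx; rewrite mulrC -normCK chiP.1 // expr1n. Qed.

Lemma unitary_char1 : chi 1%g = 1.
Proof.
have S1 := subgroup1 S_sub.
by rewrite -[LHS]mul1r -(unitary_char_conjM S1) -mulrA -chiP.2 // mulg1.
Qed.

Lemma unitary_charV x : S x -> chi x^-1%g = (chi x)^*.
Proof.
move=> Sx; have SV := subgroupV S_sub Sx.
rewrite -[LHS]mul1r -(unitary_char_conjM Sx) -mulrA -chiP.2 //.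
by rewrite mulgV unitary_char1 mulr1.
Qed.

Lemma unitary_char_eq x y : S x -> S y -> chi (x^-1 * y)%g = 1 <-> chi x = chi y.
Proof.
move=> Sx Sy; have SV := subgroupV S_sub Sx.
rewrite chiP.2 // unitary_charV //; split=> [e|<-]; last exact: unitary_char_conjM.
by rewrite -[LHS]mulr1 -e mulrA (mulrC (chi x)) unitary_char_conjM ?mul1r.
Qed.

Lemma is_subgroup_char_ker : is_subgroup ker.
Proof.
split=> [|u v /set_mem[Su u1] /set_mem[Sv v1]]; apply/mem_set; split.
- exact: subgroup1.
- exact: unitary_char1.
- by apply: subgroupM => //; exact: subgroupV.
- have SV := subgroupV S_sub Sv.
  by rewrite chiP.2 // unitary_charV // u1 v1 mul1r conjC1.
Qed.

(** First isomorphism theorem as a bijection of sets: [chi] is constant on the cosets of its kernel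
    and separates them. Equipotence transfers both finiteness and cardinality. *)
Lemma card_eq_char_ker : (chi @` S #= left_cosets_in ker S)%card.
Proof.
pose f (c : set G) := chi (xget 1%g c).
have fE x : S x -> f (left_coset ker x) = chi x.
  move=> Sx; rewrite /f; have [s [Ss s1] ->] := left_coset_repr is_subgroup_char_ker x.
  by rewrite chiP.2 // s1 mulr1.
have -> : chi @` S = f @` left_cosets_in ker S.
  apply/seteqP; split=> [_ [x Sx <-]|_ [_ [x Sx <-] <-]]; last by exists x; rewrite ?fE.
  by exists (left_coset ker x); [exists x|rewrite fE].
apply: inj_card_eq => _ _ /set_mem[x Sx <-] /set_mem[y Sy <-].
rewrite !fE // => exy; apply: left_coset_eq; first exact: is_subgroup_char_ker.
split; last exact/unitary_char_eq.
by apply: subgroupM => //; exact: subgroupV.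
Qed.

Hypothesis chi_fin : finite_set (chi @` S).

Lemma finite_left_cosets_char_ker : finite_set (left_cosets_in ker S).
Proof. by rewrite -(eq_finite_set card_eq_char_ker). Qed.

Lemma index_char_ker : Defs.index ker S = #|` fset_set (chi @` S)|.
Proof.
apply/esym/fcard_eq => //; [exact: finite_left_cosets_char_ker|].
exact: card_eq_char_ker.
Qed.

End CharacterKernel.

(** * Twisting by a character extended to [G] *)

Section Extension.
Variables (R : realType) (G : groupType) (T : heckeTriple R G).
Variable sigma : G -> R[i].
Hypothesis sigma_char : unitary_character [set: G] sigma.
Hypothesis sigma_ext : forall h, hgroup T h -> sigma h = hchar T h.
Local Notation H := (hgroup T).
Local Notation K := (hker T).
Local Notation H_sub := (hgroup_subgroup T).

Let sub_char (S : set G) : unitary_character S sigma.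
Proof. by split=> [x _|x y _ _]; [apply: sigma_char.1|apply: sigma_char.2]. Qed.

Let sigmaM x y : sigma (x * y)%g = sigma x * sigma y.
Proof. exact: sigma_char.2. Qed.

Let setT_sub : is_subgroup [set: G].
Proof. by split=> [|x y _ _]; exact: mem_set. Qed.

Let sigmaV x : sigma x^-1%g = (sigma x)^*.
Proof. exact: (unitary_charV setT_sub). Qed.

Let sigmaVM x : (sigma x)^* * sigma x = 1.
Proof. exact: (unitary_char_conjM sigma_char). Qed.

Let sigma_image : hchar T @` H = sigma @` H.
Proof. by apply/eq_imagel => x Hx; rewrite sigma_ext. Qed.

Let sigma_fin : finite_set (sigma @` H).
Proof. by rewrite -sigma_image; exact: hchar_finite_range. Qed.

Let hkerE : K = [set h | H h /\ sigma h = 1].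
Proof.
by apply/seteqP; split=> h [Hh h1]; split=> //; rewrite ?sigma_ext // -sigma_ext.
Qed.

(** Since [sigma] is multiplicative on all of [G] with commuting values, it is invariant under
    conjugation by any [x], even outside [H]. *)
Lemma hker_conj x :
  K `&` conj_set x K = [set h | (H `&` conj_set x H) h /\ sigma h = 1].
Proof.
have s1 h : sigma (x^-1 * h * x)%g = sigma h.
  by rewrite !sigmaM sigmaV mulrAC sigmaVM mul1r.
rewrite hkerE; apply/seteqP; split=> h.
  by case=> -[Hh h1] /conj_setE[Hxh _]; do !split=> //; exact/conj_setE.
case=> -[Hh /conj_setE Hxh] h1; split=> //.
by apply/conj_setE; split=> //; rewrite s1.
Qed.

(** Conjugation by [x^-1] carries one intersection to the other and preserves [sigma]; one
    inclusion, used at [x] and at [x^-1], suffices. *)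
Lemma sigma_image_conj x :
  sigma @` (H `&` conj_set x^-1%g H) = sigma @` (H `&` conj_set x H).
Proof.
suff sub y : sigma @` (H `&` conj_set y H) `<=` sigma @` (H `&` conj_set y^-1%g H).
  by apply/seteqP; split; [have := sub x^-1%g; rewrite invgK|exact: sub].
move=> _ [h [Hh /conj_setE Hyh] <-]; exists (y^-1 * h * y)%g.
  by split=> //; apply/conj_setE; rewrite invgK !mulgA mulgV mul1g mulgK.
by rewrite !sigmaM sigmaV mulrAC sigmaVM mul1r.
Qed.

(* Both sides equal [H : K `&` xKx^-1]. *)
Lemma index_hker x :
  (#|` fset_set (sigma @` H)| * Defs.index (K `&` conj_set x K) K =
   Defs.index (H `&` conj_set x H) H * #|` fset_set (sigma @` (H `&` conj_set x H))|)%N.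
Proof.
set L := H `&` conj_set x H.
have L_sub : is_subgroup L := subgroupI_conj T x.
have L_fin : finite_set (sigma @` L).
  by apply: sub_finite_set sigma_fin => _ [h [Hh _] <-]; exists h.
have K_sub : is_subgroup K by rewrite hkerE; exact: (is_subgroup_char_ker H_sub (sub_char H)).
have KL_sub : is_subgroup (K `&` conj_set x K).
  by rewrite hker_conj; exact: (is_subgroup_char_ker L_sub (sub_char L)).
have KH : K `<=` H by move=> h [].
have LH : L `<=` H by move=> h [].
have KLL : K `&` conj_set x K `<=` L by rewrite hker_conj => h [].
have KLK : K `&` conj_set x K `<=` K by move=> h [].
have HL_fin : finite_set (left_cosets_in L H) := hgroup_finite_index T x.
have LKL_fin : finite_set (left_cosets_in (K `&` conj_set x K) L).
  by rewrite hker_conj; exact: (finite_left_cosets_char_ker L_sub (sub_char L)).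
have HK_fin : finite_set (left_cosets_in K H).
  by rewrite hkerE; exact: (finite_left_cosets_char_ker H_sub (sub_char H)).
(* These cosets are among those in [H], which are finite in number by the tower through [L]. *)
have KKL_fin : finite_set (left_cosets_in (K `&` conj_set x K) K).
  have := finite_left_cosets_tower H_sub L_sub KL_sub LH KLL HL_fin LKL_fin.
  by apply: sub_finite_set => _ [h [Hh _] <-]; exists h.
have -> : #|` fset_set (sigma @` H)| = Defs.index K H 
  by rewrite hkerE (index_char_ker H_sub (sub_char H)).
have -> : #|` fset_set (sigma @` L)| = Defs.index (K `&` conj_set x K) L.
  by rewrite hker_conj (index_char_ker L_sub (sub_char L)).
by rewrite -(index_tower H_sub K_sub) // -(index_tower H_sub L_sub).
Qed.

Lemma modular_hker x : modular R[i] K x = modular R[i] H x.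
Proof.
(* The image contains [sigma 1], so its cardinality may be divided by. *)
have card_neq0 (S : set G) : S 1%g -> finite_set (sigma @` S) ->
    (#|` fset_set (sigma @` S)|)%:R != 0 :> R[i].
  move=> S1 fS; rewrite pnatr_eq0 cardfs_eq0.
  by apply/eqP => /(fset_set_set0 fS) S0; have : set0 (sigma 1%g) by rewrite -S0; exists 1%g.
have H1 := subgroup1 H_sub.
pose n : R[i] := (#|` fset_set (sigma @` H)|)%:R.
pose m y : R[i] := (#|` fset_set (sigma @` (H `&` conj_set y H))|)%:R.
have n0 : n != 0 := card_neq0 _ H1 sigma_fin.
have m0 : m x != 0.
  apply: card_neq0; first exact: (subgroup1 (subgroupI_conj T x)).
  by apply: sub_finite_set sigma_fin => _ [h [Hh _] <-]; exists h.
have indexE y : (Defs.index (K `&` conj_set y K) K)%:R =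
    (Defs.index (H `&` conj_set y H) H)%:R * (m y / n) :> R[i].
  by rewrite mulrA -natrM -index_hker natrM mulrAC divff ?mul1r.
(* Numerator and denominator now carry the same factor [m x / n], which cancels. *)
rewrite /modular !indexE /m sigma_image_conj -/(m x).
by rewrite -mulf_div divff ?mulr1 // mulf_neq0 ?invr_eq0.
Qed.

(** The conjugates of [sigma h] and [sigma k] coming from the twist cancel the factors from
    equivariance, and the support does not grow. *)
Lemma is_hecke_untwist f : is_hecke T f ->
  is_hecke (trivial_triple T) (fun x => (sigma x)^* * f x).
Proof.
move=> [ff fE]; apply/is_hecke_trivialE; split=> [|h k x Hh Hk].
  apply: sub_finite_set ff => _ [x /= fx <-]; exists x => //=.
  by apply: contra_neq fx => ->; rewrite mulr0.
rewrite fE // -!sigma_ext // !sigmaM !rmorphM /=.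
by rewrite mulrACA sigmaVM mulr1 mulrACA sigmaVM mul1r.
Qed.

Lemma is_hecke_twist f : is_hecke (trivial_triple T) f ->
  is_hecke T (fun x => sigma x * f x).
Proof.
move=> /is_hecke_trivialE[ff fE]; split=> [|h k x Hh Hk].
  apply: sub_finite_set ff => _ [x /= fx <-]; exists x => //=.
  by apply: contra_neq fx => ->; rewrite mulr0.
by rewrite fE // -!sigma_ext // !sigmaM !mulrA mulrAC.
Qed.

(** Both sums run over the same cosets with the same representatives, so they can be compared
    summand by summand. *)
Lemma hecke_conv_untwist f g x :
  (sigma x)^* * hecke_conv T f g x =
  hecke_conv (trivial_triple T) (fun y => (sigma y)^* * f y)
                                (fun y => (sigma y)^* * g y) x.
Proof.
rewrite /hecke_conv mulr_fsumr; apply: eq_fsbigr => c _ /=.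
by rewrite mulrACA -rmorphM -sigmaM mulgA mulgV mul1g.
Qed.

(** The twist at [x^-1], conjugated by the involution, is [sigma x^-1], that is [(sigma x)^*]; the
    modular factors agree by [modular_hker]. *)
Lemma hecke_star_untwist f x :
  (sigma x)^* * hecke_star T f x =
  hecke_star (trivial_triple T) (fun y => (sigma y)^* * f y) x.
Proof.
rewrite /hecke_star hker_trivial modular_hker rmorphM /= conjCK sigmaV.
by rewrite mulrCA.
Qed.

End Extension.

Theorem proposition8p1 (R : realType) (G : groupType) (T : heckeTriple R G)
    (sigma : G -> R[i]) (sigma_char : unitary_character [set: G] sigma)
    (sigma_ext : forall h, hgroup T h -> sigma h = hchar T h) :
  exists Phi : hecke T -> hecke (trivial_triple T),
    (forall (f : hecke T) (x : G), Phi f x = (sigma x)^* * f x) /\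
    is_star_isomorphism Phi.
Proof.
pose Phi (f : hecke T) :=
  to_hecke (is_hecke_untwist sigma_char sigma_ext (heckeP f)).
(* The inverse of [Phi] multiplies by [sigma], whose values have modulus 1. *)
pose Psi (f : hecke (trivial_triple T)) :=
  to_hecke (is_hecke_twist sigma_char sigma_ext (heckeP f)).
exists Phi; split=> [//|]; split.
- move=> a f g; apply/val_inj/funext => x /=.
  rewrite [LHS]mulrDr; congr (_ + _); exact: mulrCA.
- exists Psi => f; apply/val_inj/funext => x /=.
    by rewrite mulrA [sigma x * _]mulrC (unitary_char_conjM sigma_char) ?mul1r.
  by rewrite mulrA (unitary_char_conjM sigma_char) ?mul1r.
- move=> f g; apply/val_inj/funext => x; exact: hecke_conv_untwist.
- move=> f; apply/val_inj/funext => x; exact: hecke_star_untwist.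
Qed.
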